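(* Let $n,m\geq1$ be integers, $p\in(0,1)$, let $\pi\sim\nu^{(p)}_{n,m}$, and let $D_n=\operatorname{des}(\pi)$. Put $\delta=2p-1$ and $S_j(m):=\sum_{a=0}^{m-1}a^j$ for $j\ge1$. Then $$\mathbb{E}[D_n]=\frac{n-1}{2}+\delta\left(m-\frac{n+1}{2}-\frac{n+1}{m^n}S_n(m)\right).$$ Moreover, $$\begin{aligned}\mathbb{E}[D_n(D_n+1)]&=\frac{n(n+1)}{4}-\frac m2+\frac{(n+1)mS_n(m)-(n+2)S_{n+1}(m)}{m^n}\\&\quad+\delta\left(nm-\frac{n(n+1)}{2}-\frac{n(n+1)}{m^n}S_n(m)\right)\\&\quad+\delta^2\left(m^2-\left(n+\tfrac12\right)m+\frac{n(n+1)}{4}+\frac{(n^2-1)mS_n(m)-n(n+2)S_{n+1}(m)}{m^n}\right).\end{aligned}$$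
   Context: Asymmetric shelf shuffle: let $m\ge 1$ be an integer, $p\in(0,1)$, $q=1-p$. A deck of $n$ cards labelled $1,\ldots,n$ from top to bottom is dealt sequentially from the bottom (card $n$ first, card $1$ last). Each card is assigned to one of $m$ labelled shelves independently and uniformly at random, and is placed at the top of the existing pile on that shelf with probability $p$ and at the bottom with probability $q$, independently of everything else. The shuffled deck is formed by joining the piles in shelf order (shelf $1$ on top, then shelf $2$, and so on). The resulting random permutation is $\pi=(\pi_1,\ldots,\pi_n)\in S_n$, where $\pi_i$ is the label of the card in position $i$ from the top, and $\nu^{(p)}_{n,m}$ denotes its law on $S_n$. $\operatorname{des}(\pi)=|\{i\in\{1,\ldots,n-1\}:\pi_i>\pi_{i+1}\}|$ is the number of descents. *)

(* Defs.v *)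
From HB Require Import structures.
From mathcomp Require Import all_boot all_order all_algebra perm.

Set Implicit Arguments.
Unset Strict Implicit.
Unset Printing Implicit Defensive.

Import Order.TTheory GRing.Theory Num.Theory.
Local Open Scope ring_scope.

(* Cards, positions and shelves are numbered from 0, so that the card labelled
   k.+1 is the element of value k in 'I_n. *)

(* The random choices: each card gets a shelf and a side of the pile on that
   shelf (true = top, false = bottom). *)
Definition shelf_choice (n m : nat) : finType := {ffun 'I_n -> 'I_m * bool}.

(* Piles are listed from top to bottom. *)
Definition place_card (n m : nat) (w : shelf_choice n m) (c : 'I_n)
    (piles : {ffun 'I_m -> seq 'I_n}) : {ffun 'I_m -> seq 'I_n} :=
  [ffun s => if s == (w c).1
             then if (w c).2 then c :: piles s else rcons (piles s) c
             else piles s].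

(* foldr handles the last element of the list first: the deck is dealt from
   the bottom. *)
Definition shelf_piles (n m : nat) (w : shelf_choice n m) :
    {ffun 'I_m -> seq 'I_n} :=
  foldr (place_card w) [ffun=> [::]] (enum 'I_n).

Definition shuffled_deck (n m : nat) (w : shelf_choice n m) : seq 'I_n :=
  flatten [seq shelf_piles w s | s <- enum 'I_m].

Definition choice_prob (R : realFieldType) (n m : nat) (p : R)
    (w : shelf_choice n m) : R :=
  \prod_(c : 'I_n) (m%:R^-1 * (if (w c).2 then p else 1 - p)).

(* A permutation s stands for the deck s 0, s 1, ... read from the top. *)
Definition shelf_law (R : realFieldType) (n m : nat) (p : R) (s : 'S_n) : R :=
  \sum_(w : shelf_choice n m | shuffled_deck w == [seq s i | i <- enum 'I_n])
    choice_prob p w.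

Definition expectation (R : realFieldType) (n : nat) (law f : 'S_n -> R) : R :=
  \sum_(s : 'S_n) law s * f s.

Definition des (n : nat) (s : 'S_n) : nat :=
  #|[set i : 'I_n | [exists j : 'I_n, (val j == i.+1) && (s j < s i)%N]]|.

Definition power_sum (R : realFieldType) (j m : nat) : R :=
  \sum_(0 <= a < m) a%:R ^+ j.

Lemma perm_shuffled_deck (n m : nat) (w : shelf_choice n m) :
  perm_eq (shuffled_deck w) (enum 'I_n).
Proof.
rewrite /shuffled_deck /shelf_piles; elim: (enum 'I_n) => [|c cs IH] /=.
  rewrite (_ : flatten _ = [::]) //.
  by elim: (enum 'I_m) => //= s t ->; rewrite ffunE.
set P := foldr _ _ _ in IH *.
rewrite -(perm_cons c) in IH; apply: perm_trans IH.
apply/seq.permP => a /=; rewrite !count_flatten -!map_comp.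
rewrite !sumnE !big_map -!enumT !big_enum /=.
rewrite (bigD1 (w c).1) //= [in RHS](bigD1 (w c).1) //= ffunE eqxx addnA.
congr (_ + _)%N.
  by case: (w c).2 => //=; rewrite -cats1 count_cat /= addn0 addnC.
by apply: eq_bigr => s /negPf ns; rewrite ffunE ns.
Qed.

Lemma sum_shelf_law (R : realFieldType) (n m : nat) (p : R) :
  (0 < m)%N -> \sum_(s : 'S_n) shelf_law m p s = 1.
Proof.
move=> m_gt0; rewrite /shelf_law (exchange_big_dep xpredT) //=.
rewrite (eq_bigr (choice_prob p)) => [|w _].
  rewrite /choice_prob -(bigA_distr_bigA
    (fun (c : 'I_n) (x : 'I_m * bool) => m%:R^-1 * (if x.2 then p else 1 - p))).
  apply: big1 => c _.
  rewrite -(pair_bigA _ (fun (s : 'I_m) b => m%:R^-1 * (if b then p else 1 - p))).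
  rewrite (eq_bigr (fun=> m%:R^-1)) /= => [|s _].
    by rewrite sumr_const card_ord -[LHS]mulr_natl divff // pnatr_eq0 -lt0n.
  by rewrite big_bool /= -mulrDr addrC subrK mulr1.
have pw := perm_shuffled_deck w.
have sz : size (shuffled_deck w) = n by rewrite (perm_size pw) size_enum_ord.
have un : uniq (shuffled_deck w) by rewrite (perm_uniq pw) enum_uniq.
pose f (i : 'I_n) := nth i (shuffled_deck w) i.
have f_inj : injective f.
  move=> i j; rewrite /f (set_nth_default j) ?sz // => /eqP.
  by rewrite nth_uniq ?sz // => /eqP /val_inj.
have fE : shuffled_deck w = [seq perm f_inj i | i <- enum 'I_n].
  have [n0|n_gt0] := posnP n.
    by apply/etrans/esym/size0nil; [apply/size0nil; rewrite sz
                                   | rewrite size_map size_enum_ord].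
  pose x0 := Ordinal n_gt0.
  apply: (@eq_from_nth _ x0) => [|i]; first by rewrite size_map size_enum_ord.
  rewrite sz => lt_in; rewrite (nth_map x0) ?size_enum_ord // permE /f.
  by rewrite nth_enum_ord // (set_nth_default x0) // sz.
rewrite (big_pred1 (perm f_inj)) // => s /=; rewrite fE.
apply/eqP/eqP => [/eq_in_map eq_s | ->] //.
by apply/permP => i; rewrite eq_s // mem_enum.
Qed.

(* Main.v *)
Require Import Defs.
From HB Require Import structures.
From mathcomp Require Import all_boot all_order all_algebra perm.
From mathcomp Require Import ring.
Import Order.TTheory GRing.Theory Num.Theory.
Local Open Scope ring_scope.

(** Once the shelves and sides are chosen, the shuffled deck is the arrangement
    of the cards sorted for an explicit total order ([shuffled_deck_eq]).  The
    probability of a deck is therefore a transfer-matrix product along its gaps,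
    and it depends only on the pattern of ascents and descents
    ([shelf_law_shelf_eval]).  Let ['X] be a formal variable that marks a change
    of shelf, so that ['X^k] counts [binom(m, k.+1)] choices of nonempty
    shelves.  A pattern then has the weight in which each valley (a descent
    followed by an ascent) contributes [K = 'X * (1 + 'X)], each other ascent
    [u = p + 'X] and each other descent [s = (1 - p) + 'X].

    Building all decks by inserting cards in decreasing order of labels acts on
    such weights as a derivation that treats [u] and [s] alike.  Hence the sum
    over all decks is a combination of monomials [(u + s) ^+ a * K ^+ v] with
    [a + 2 v = n - 1] ([sum_weight_words]).  Here [sigma = u + s = 1 + 2 'X] does
    not involve [p].  Marking descents replaces [s] and [K] by [t s] and [t K],
    and differentiating at [t = 1] expresses the two moments through the
    gamma expansion and its first two [sigma]-derivatives, with coefficients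
    polynomial in [delta = 2 p - 1] ([sum_des_gamma], [sum_des_des1_gamma]).

    On the curve [(sigma, K)] one has [sigma ^+ 2 - 4 K = 1]; with homogeneity
    this reduces the [sigma]-derivatives to derivatives in ['X] ([gamma_polyS]).
    Under the evaluation in [m], the operator [f |-> (K f)^`()] is
    multiplication by [m], and multiplication by ['X] is summation over the
    numbers smaller than [m].  Since the probabilities add up to 1, the gamma
    expansion itself evaluates to [m ^+ n], and its [sigma]-derivatives evaluate
    to expressions in the power sums of [m]. *)

(** * Evaluating polynomials at binomial coefficients *)

(** The linear functional sending ['X^k] to [binom(m, k)].  Up to a factor
    [1 / (1 - y)], the generating function in [m] of its values is the
    polynomial taken at [y / (1 - y)]. *)
Definition binom_eval {R : comNzRingType} (m : nat) (f : {poly R}) : R :=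
  \sum_(k < m.+1) f`_k * 'C(m, k)%:R.

Lemma binom_eval_is_linear (R : comNzRingType) (m : nat) :
  linear_for *%R (@binom_eval R m).
Proof.
move=> a f g; rewrite /binom_eval mulr_sumr -big_split /=.
by apply: eq_bigr => k _; rewrite coefD coefZ mulrDl mulrA.
Qed.

HB.instance Definition _ (R : comNzRingType) (m : nat) :=
  GRing.isLinear.Build R {poly R} R _ (@binom_eval R m)
    (binom_eval_is_linear R m).

Lemma binom_evalXS (R : comNzRingType) (m : nat) (f : {poly R}) :
  binom_eval m.+1 ('X * f) = binom_eval m ('X * f) + binom_eval m f.
Proof.
rewrite /binom_eval big_ord_recl coefXM mul0r add0r.
under eq_bigr => k _ do rewrite coefXM /= /bump /= add1n /= binS natrD mulrDr.
rewrite big_split /=; congr (_ + _).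
rewrite big_ord_recr /= bin_small // mulr0 addr0.
rewrite [RHS]big_ord_recl coefXM mul0r add0r.
by apply: eq_bigr => k _; rewrite coefXM /= /bump /= add1n.
Qed.

(** Hockey-stick identity: multiplication by ['X] is a partial sum in [m].
    This is where the power sums come from. *)
Lemma binom_evalX (R : comNzRingType) (m : nat) (f : {poly R}) :
  binom_eval m ('X * f) = \sum_(i < m) binom_eval i f.
Proof.
elim: m => [|m IH].
  by rewrite /binom_eval big_ord1 big_ord0 coefXM mul0r.
by rewrite binom_evalXS IH big_ord_recr.
Qed.

(** Sends ['X^k] to [binom(m, k.+1)], the number of ways to choose which of the
    [m] shelves are nonempty when the deck is cut in [k] places. *)
Definition shelf_eval {R : comNzRingType} (m : nat) (f : {poly R}) : R :=
  binom_eval m ('X * f).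

Lemma shelf_eval_is_linear (R : comNzRingType) (m : nat) :
  linear_for *%R (@shelf_eval R m).
Proof.
by move=> a f g; rewrite /shelf_eval mulrDr -scalerAr linearP.
Qed.

HB.instance Definition _ (R : comNzRingType) (m : nat) :=
  GRing.isLinear.Build R {poly R} R _ (@shelf_eval R m)
    (shelf_eval_is_linear R m).

Lemma shelf_evalX (R : comNzRingType) (m : nat) (f : {poly R}) :
  shelf_eval m ('X * f) = \sum_(i < m) shelf_eval i f.
Proof. exact: binom_evalX. Qed.

(** On generating functions in [m] the factor [m] is [y d/dy], and [y / (1 - y)]
    has [y]-derivative [K / y] for [K = 'X * (1 + 'X)]; the generating function
    of [shelf_eval] carries an extra factor [K], hence the [K] under the
    derivative. *)
Lemma shelf_eval_deriv (R : comNzRingType) (m : nat) (f : {poly R}) :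
  shelf_eval m (('X * (1 + 'X) * f)^`()) = m%:R * shelf_eval m f.
Proof.
have mono k : shelf_eval m (('X * (1 + 'X) * 'X^k : {poly R})^`())
              = m%:R * shelf_eval m 'X^k.
  have E (j : nat) : shelf_eval m ('X^j : {poly R}) = 'C(m, j.+1)%:R.
    rewrite /shelf_eval -exprS /binom_eval.
    have [lt_jm|le_mj] := ltnP j m.
      rewrite (bigD1 (Ordinal (lt_jm : (j.+1 < m.+1)%N))) //= coefXn eqxx mul1r.
      rewrite big1 ?addr0 // => i /negPf; rewrite -val_eqE /= coefXn => ->.
      by rewrite mul0r.
    rewrite bin_small // big1 // => i _; rewrite coefXn.
    have lt_mj : (m < j.+1)%N by rewrite ltnS.
    by rewrite (ltn_eqF (leq_ltn_trans _ lt_mj)) ?mul0r // -ltnS.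
  have -> : ('X * (1 + 'X) * 'X^k : {poly R})^`()
            = k.+1%:R *: 'X^k + k.+2%:R *: 'X^(k.+1).
    rewrite mulrDr mulr1 mulrDl -mulrA -!exprS derivD !derivXn /=.
    by rewrite !scaler_nat.
  rewrite linearD !linearZ /= !E -!natrM -natrD; congr _%:R.
  rewrite (mul_bin_left m k.+1) -mulnDl.
  have [lt_km|le_mk] := ltnP k m; first by rewrite subnKC.
  by rewrite bin_small ?muln0.
rewrite -[f]coefK poly_def mulr_sumr !linear_sum mulr_sumr.
apply: eq_bigr => k _.
by rewrite -scalerAr !linearZ /= mono mulrCA.
Qed.

(** * Descent words and their weights *)

(** A descent word lists the gaps of a deck, [true] for a descent.  It is cut
    into tokens: a valley (descent then ascent) weighs [K] as a single token,
    the remaining ascents weigh [u] and the remaining descents [s]. *)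
Fixpoint weight {A : comNzRingType} (u s K : A) (w : seq bool) : A :=
  match w with
  | [::] => 1
  | false :: w1 => u * weight u s K w1
  | true :: w1 => if w1 is false :: w2 then K * weight u s K w2
                  else s * weight u s K w1
  end.

Lemma weightDD (A : comNzRingType) (u s K : A) (w : seq bool) :
  weight u s K [:: true, true & w] = s * weight u s K (true :: w).
Proof. by []. Qed.

(** Induction along the tokens. *)
Lemma word_ind (P : seq bool -> Prop) :
  P [::] -> (forall w, P w -> P (false :: w)) -> P [:: true] ->
  (forall w, P w -> P [:: true, false & w]) ->
  (forall w, P (true :: w) -> P [:: true, true & w]) -> forall w, P w.
Proof.
move=> P0 PA P1 PDA PDD w.
suff: P w /\ P (true :: w) by case.
elim: w => [|[] w [IH1 IH2]]; split=> //; [exact: PDD | exact: PA | exact: PDA].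
Qed.

Lemma rmorph_weight (A B : comNzRingType) (f : {rmorphism A -> B}) u s K w :
  f (weight u s K w) = weight (f u) (f s) (f K) w.
Proof.
elim/word_ind: w => [|w IH||w IH|w IH] /=; rewrite ?rmorphM ?rmorph1 ?IH //.
Qed.

(** A card smaller than all others, inserted inside a gap, replaces that gap by
    a valley, whatever the sign of the gap was. *)
Fixpoint splits (w : seq bool) : seq (seq bool) :=
  if w is d :: w1 then [:: true, false & w1] :: map (cons d) (splits w1)
  else [::].

(** All insertions of a new smallest card, from the top of the deck to its
    bottom. *)
Definition inserts (w : seq bool) : seq (seq bool) :=
  (false :: w) :: rcons (splits w) (rcons w true).

Lemma weight_rcons (A : comNzRingType) (u s K : A) (w : seq bool) :
  weight u s K (rcons w true) = s * weight u s K w.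
Proof.
elim/word_ind: w => [|w IH||w IH|w IH] //=.
- by rewrite IH; ring.
- by rewrite IH; ring.
- by move: IH => /= ->.
Qed.

(** Splitting a free ascent turns [u] into [K], splitting a free descent turns
    [s] into [K], and splitting the two gaps of a valley turns [K] into [u * K]
    and [s * K].  Hence the splits of a word act on weights as the derivation
    with [u, s |-> K] and [K |-> (u + s) * K], here realised as the derivative
    at 0 of a first-order perturbation of the weights. *)
Lemma sum_splits (A : comNzRingType) (u s K : A) (w : seq bool) :
  \sum_(x <- splits w) weight u s K x
    = (weight (u%:P + K *: 'X) (s%:P + K *: 'X)
         (K%:P + ((u + s) * K) *: 'X) w)^`().[0].
Proof.
have at0 w' : (weight (u%:P + K *: 'X) (s%:P + K *: 'X)
         (K%:P + ((u + s) * K) *: 'X) w').[0] = weight u s K w'.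
  rewrite -horner_evalE rmorph_weight /= !horner_evalE.
  by rewrite !hornerE ?mulr0 ?addr0.
elim/word_ind: w => [|w IH||w IH|w IH].
- by rewrite big_nil derivC hornerC.
- rewrite big_cons big_map /= -mulr_sumr IH.
  by rewrite derivM !derivE !hornerE at0; ring.
- by rewrite /= big_cons big_nil /= mulr1 !derivE !hornerE; ring.
- rewrite /= !big_cons !big_map /= -mulr_sumr IH.
  by rewrite derivM !derivE !hornerE at0 /=; ring.
- have -> : splits [:: true, true & w]
            = [:: true, false, true & w] :: map (cons true) (splits (true :: w)).
    by [].
  have tails : \sum_(x <- splits (true :: w)) weight u s K (true :: x)
             = s * \sum_(x <- splits (true :: w)) weight u s K x.
    by rewrite [splits _]/= !big_cons !big_map mulrDr mulr_sumr.
  by rewrite big_cons big_map tails IH !weightDD derivM !derivE !hornerE at0.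
Qed.

(** A pair [(a, v)] stands for [(u + s) ^+ a * K ^+ v]; the derivation above
    together with the insertions at both ends sends it to [v + 1] times
    [(a + 1, v)] and [2 a] times [(a - 1, v + 1)]. *)
Definition gamma_succ (x : nat * nat) : seq (nat * nat) :=
  nseq x.2.+1 (x.1.+1, x.2) ++ nseq (x.1 * 2)%N (x.1.-1, x.2.+1).

Fixpoint gamma_terms (n : nat) : seq (nat * nat) :=
  if n is n1.+1 then flatten (map gamma_succ (gamma_terms n1))
  else [:: (0, 0)%N].

Lemma gamma_terms_size (n a v : nat) :
  (a, v) \in gamma_terms n -> (a + 2 * v)%N = n.
Proof.
elim: n a v => [|n IH] a v /=; first by rewrite inE => /eqP[-> ->].
move=> /flattenP[_ /mapP[[b w] /IH eq_n ->]]; rewrite mem_cat !mem_nseq.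
case/orP=> [/eqP[-> ->]|/andP[b_gt0 /eqP[-> ->]]]; first by rewrite -eq_n.
by case: b b_gt0 eq_n => //= b _ <-; rewrite mulnS addnA addn2 addSn.
Qed.

(** The descent words of all decks of [n.+1] cards, with multiplicity. *)
Fixpoint words (n : nat) : seq (seq bool) :=
  if n is n1.+1 then flatten (map inserts (words n1)) else [:: [::]].

Lemma big_nseq_const (A : nmodType) (T : Type) (k : nat) (x : T) (F : T -> A) :
  \sum_(y <- nseq k x) F y = F x *+ k.
Proof. by rewrite big_nseq; elim: k => //= k ->; rewrite mulrS. Qed.

(** Gamma expansion: the total weight of all decks depends on [u] and [s] only
    through [u + s].  The induction hypothesis is used over [{poly A}], at the
    perturbed weights of [sum_splits]. *)
Lemma sum_weight_words (n : nat) (A : comNzRingType) (u s K : A) :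
  \sum_(w <- words n) weight u s K w
    = \sum_(x <- gamma_terms n) (u + s) ^+ x.1 * K ^+ x.2.
Proof.
elim: n A u s K => [|n IH] A u s K; first by rewrite !big_seq1 mulr1.
rewrite /= !big_flatten !big_map /=.
under eq_bigr => w _ do
  rewrite /inserts big_cons big_rcons /= weight_rcons sum_splits addrCA -mulrDl addrC.
rewrite big_split /= -mulr_sumr IH -horner_sum -(raddf_sum (@deriv _)) /= IH.
rewrite raddf_sum horner_sum mulr_sumr -big_split; apply: eq_bigr => -[a v] _ /=.
rewrite /gamma_succ big_cat !big_nseq_const /=.
rewrite derivM !deriv_exp !derivE !hornerE /= !hornerMn !hornerE /=.
rewrite ?mulr0 ?addr0 mulrnA.
by case: v => [|v] /=; rewrite ?mulr0n !exprS; ring.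
Qed.

Lemma weight_scale (A : comNzRingType) (t u s K : A) (w : seq bool) :
  weight u (t * s) (t * K) w = t ^+ count id w * weight u s K w.
Proof.
elim/word_ind: w => [|w IH||w IH|w IH].
- by rewrite mulr1.
- by rewrite /= IH mulrCA.
- by rewrite /= expr1 mulrA.
- by rewrite /= IH add0n add1n exprS; ring.
- by rewrite !weightDD IH [count _ [:: true, true & _]]/= add1n exprS; ring.
Qed.

(** Marking every descent by ['X] replaces [s] by [s 'X] and, as a valley has
    exactly one descent, [K] by [K 'X]. *)
Lemma descent_poly_words (A : comNzRingType) (n : nat) (u s K : A) :
  \sum_(w <- words n) weight u s K w *: 'X^(count id w)
    = \sum_(x <- gamma_terms n) (u%:P + s *: 'X) ^+ x.1 * (K *: 'X) ^+ x.2.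
Proof.
rewrite -(mul_polyC s) -(mul_polyC K) ![_ * 'X]mulrC -sum_weight_words.
apply: eq_bigr => w _.
by rewrite weight_scale -rmorph_weight -mul_polyC mulrC.
Qed.

(** First derivative at 1 of the descent polynomial. *)
Lemma sum_des_words (A : comNzRingType) (n : nat) (u s K : A) :
  \sum_(w <- words n) (count id w)%:R * weight u s K w
    = \sum_(x <- gamma_terms n)
        (x.1%:R * s * (u + s) ^+ x.1.-1 + x.2%:R * (u + s) ^+ x.1) * K ^+ x.2.
Proof.
have := congr1 (fun f => f^`().[1]) (descent_poly_words A n u s K).
rewrite /= !raddf_sum !horner_sum /= => eq_d.
transitivity (\sum_(w <- words n) (weight u s K w *: 'X^(count id w))^`().[1]).
  apply: eq_bigr => w _.
  by rewrite derivZ derivXn !hornerE hornerMn !hornerE expr1n mulrC.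
rewrite eq_d; apply: eq_bigr => -[a v] _ /=.
rewrite derivM !deriv_exp !derivE !hornerE /= !hornerMn !hornerE /=.
by case: v => [|v] /=; rewrite ?mulr0n ?exprS; ring.
Qed.

(** Second derivative at 1 of ['X] times the descent polynomial. *)
Lemma sum_des_des1_words (A : comNzRingType) (n : nat) (u s K : A) :
  \sum_(w <- words n) (count id w * (count id w + 1))%:R * weight u s K w
    = \sum_(x <- gamma_terms n)
        (x.1%:R * (x.1%:R - 1) * s ^+ 2 * (u + s) ^+ (x.1 - 2)
         + 2 * x.1%:R * (x.2%:R + 1) * s * (u + s) ^+ x.1.-1
         + x.2%:R * (x.2%:R + 1) * (u + s) ^+ x.1) * K ^+ x.2.
Proof.
have := congr1 (fun f => ('X * f)^`()^`().[1]) (descent_poly_words A n u s K).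
rewrite /= !mulr_sumr !raddf_sum !horner_sum /= => eq_d.
transitivity (\sum_(w <- words n)
    ('X * (weight u s K w *: 'X^(count id w)))^`()^`().[1]).
  apply: eq_bigr => w _.
  rewrite -scalerAr -exprS !derivZ derivXn derivMn derivXn /=.
  rewrite !hornerE !hornerMn !hornerE expr1n -mulrnA addn1 mulnC.
  by rewrite mulrC mulr_natr.
rewrite eq_d; apply: eq_bigr => -[a v] _ /=.
rewrite exprZn -scalerAr -scalerAr !derivZ mulrCA -exprS.
rewrite !(derivM, derivD, deriv_exp, derivMn, derivZ, derivX, derivC).
rewrite !(hornerE, hornerMn) /= !expr1n subn2.
by case: a => [|a]; case: v => [|v] /=; rewrite ?mulr0n ?exprS; ring.
Qed.

(** * Dealing is sorting *)

(** Whether a card with choice [x] may lie directly above a card with choice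
    [y], when [d] tells that the upper label is the larger one.  On one shelf the
    cards placed on top increase and precede those placed at the bottom, which
    decrease: an ascent needs an upper card placed on top, a descent a lower
    card placed at the bottom. *)
Definition follows {m : nat} (d : bool) (x y : 'I_m * bool) : bool :=
  ((x.1 < y.1)%N) || ((x.1 == y.1) && (if d then ~~ y.2 else x.2)).

Definition deck_order {n m : nat} (w : shelf_choice n m) : rel 'I_n :=
  fun x y => follows (y < x)%N (w x) (w y).

Lemma deck_order_trans (n m : nat) (w : shelf_choice n m) :
  transitive (deck_order w).
Proof.
move=> y x z; rewrite /deck_order /follows -!val_eqE /=.
case: (w x) (w y) (w z) => [sx cx] [sy cy] [sz cz] /=.
case/orP=> [lt_xy|/andP[/eqP exy sxy]]; case/orP=> [lt_yz|/andP[/eqP eyz syz]].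
- by rewrite (ltn_trans lt_xy lt_yz).
- by rewrite -eyz lt_xy.
- by rewrite exy lt_yz.
- rewrite exy eyz eqxx ltnn /=.
  case: (ltnP y x) sxy => [lt_yx|le_xy] sxy; case: (ltnP z y) syz => [lt_zy|le_yz] syz.
  + by rewrite (ltn_trans lt_zy lt_yx).
  + by rewrite syz in sxy.
  + by case: ltnP => _ //.
  + by rewrite ltnNge (leq_trans le_xy le_yz).
Qed.

Lemma deck_order_anti (n m : nat) (w : shelf_choice n m) :
  antisymmetric (deck_order w).
Proof.
move=> x y; rewrite /deck_order /follows -!val_eqE /=.
case: (w x) (w y) => [sx cx] [sy cy] /= /andP[].
case/orP=> [lt_xy|/andP[/eqP exy sxy]]; case/orP=> [lt_yx|/andP[/eqP eyx syx]].
- by have := ltn_trans lt_xy lt_yx; rewrite ltnn.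
- by rewrite eyx ltnn in lt_xy.
- by rewrite exy ltnn in lt_yx.
- apply: val_inj; case: ltngtP sxy syx => //= _ a b.
  + by rewrite b in a.
  + by rewrite a in b.
Qed.

(** A newly dealt card is smaller than the cards already dealt, so it precedes
    its pile when placed on top and follows it when placed at the bottom. *)
Lemma deck_order_sorted (n m : nat) (w : shelf_choice n m) :
  sorted (deck_order w) (shuffled_deck w).
Proof.
rewrite (sorted_pairwise (@deck_order_trans _ _ w)).
have piles_ok : forall s, all (fun c => (w c).1 == s) (shelf_piles w s)
                  && pairwise (deck_order w) (shelf_piles w s).
  rewrite /shelf_piles.
  have: pairwise (fun x y : 'I_n => (x < y)%N) (enum 'I_n).
    have := iota_ltn_sorted 0 n; rewrite -val_enum_ord sorted_map.
    by rewrite sorted_pairwise // => y x z; apply: ltn_trans.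
  elim: (enum 'I_n) => [|c cs IH]; first by move=> _ s; rewrite ffunE.
  rewrite pairwise_cons => /andP[/allP c_min /IH{}IH] s /=.
  have sub t : {subset foldr (place_card w) [ffun=> [::]] cs t <= cs}.
    move=> x; elim: (cs) t => [|d ds IHd] t /=; first by rewrite ffunE.
    rewrite ffunE inE; case: ifP => [_|_ /IHd ->]; last by rewrite orbT.
    by case: (w d).2; rewrite ?mem_rcons inE => /orP[->|/IHd ->]; rewrite ?orbT.
  rewrite ffunE; case: ifP => [/eqP ->|_]; last exact: IH.
  have /andP[/allP in_s srt] := IH (w c).1.
  case side: (w c).2.
    rewrite /= eqxx srt andbT; apply/andP; split; first exact/allP.
    apply/allP => x xP; rewrite /deck_order /follows (eqP (in_s x xP)) eqxx ltnn.
    by rewrite ltnNge ltnW ?c_min ?(sub _ _ xP).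
  rewrite all_rcons pairwise_rcons eqxx srt andbT /=; apply/andP; split.
    exact/allP.
  apply/allP => x xP; rewrite /deck_order /follows (eqP (in_s x xP)) eqxx ltnn.
  by rewrite c_min ?(sub _ _ xP) // side.
rewrite /shuffled_deck.
have: pairwise (fun x y : 'I_m => (x < y)%N) (enum 'I_m).
  have := iota_ltn_sorted 0 m; rewrite -val_enum_ord sorted_map.
  by rewrite sorted_pairwise // => y x z; apply: ltn_trans.
elim: (enum 'I_m) => //= s ss IH /andP[/allP s_min /IH{}IH].
have /andP[/allP in_s srt] := piles_ok s.
rewrite pairwise_cat srt IH !andbT; apply/allrelP => x y /in_s/eqP xs.
case/flattenP=> _ /mapP[t t_ss ->].
have /andP[/allP in_t _] := piles_ok t; move=> /in_t/eqP yt.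
by rewrite /deck_order /follows xs yt s_min.
Qed.

(** A deck is the unique sorted arrangement of the cards, so that producing a
    given deck becomes a condition on its adjacent cards only. *)
Lemma shuffled_deck_eq (n m : nat) (w : shelf_choice n m) (t : seq 'I_n) :
  perm_eq t (enum 'I_n) -> (shuffled_deck w == t) = sorted (deck_order w) t.
Proof.
move=> t_perm; apply/eqP/idP => [<-|t_srt]; first exact: deck_order_sorted.
apply: (sorted_eq (@deck_order_trans _ _ w) (@deck_order_anti _ _ w)) => //.
  exact: deck_order_sorted.
by rewrite (perm_trans (perm_shuffled_deck w)) // perm_sym.
Qed.

Definition descent_word (t : seq nat) : seq bool :=
  if t is x :: t1 then pairmap (fun a b => (b < a)%N) x t1 else [::].

(** [l] lists the choices of the successive cards below a card with choice [x],
    [w] the signs of the gaps between them. *)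
Fixpoint chain {m : nat} (x : 'I_m * bool) (w : seq bool)
    (l : seq ('I_m * bool)) : bool :=
  match w, l with
  | d :: w1, y :: l1 => follows d x y && chain y w1 l1
  | _, _ => true
  end.

Lemma path_deck_order (n m : nat) (w : shelf_choice n m) (c : 'I_n)
    (t : seq 'I_n) :
  path (deck_order w) c t
    = chain (w c) (descent_word (map val (c :: t))) (map w t).
Proof. by elim: t c => //= d t IH c; rewrite IH. Qed.

Lemma big_tuple_cons (A : nmodType) (X : finType) (k : nat)
    (F : seq X -> A) :
  \sum_(l : k.+1.-tuple X) F l = \sum_(x : X) \sum_(l : k.-tuple X) F (x :: l).
Proof.
rewrite pair_big /= (reindex (fun a : X * k.-tuple X => cons_tuple a.1 a.2)) //.
exists (fun l : k.+1.-tuple X => (thead l, behead_tuple l)) => [[x l] _|l _] /=.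
  by congr (_, _); apply: val_inj.
by rewrite [RHS]tuple_eta; apply: val_inj.
Qed.

(** Transfer-matrix form of the sum over all admissible lists of choices. *)
Fixpoint chain_sum {R : comNzRingType} {m : nat} (g : 'I_m * bool -> R)
    (x : 'I_m * bool) (w : seq bool) : R :=
  if w is d :: w1 then \sum_(y | follows d x y) g y * chain_sum g y w1 else 1.

Lemma sum_chain (R : comNzRingType) (m : nat) (g : 'I_m * bool -> R)
    (w : seq bool) (x : 'I_m * bool) :
  \sum_(l : (size w).-tuple ('I_m * bool) | chain x w l) \prod_(y <- l) g y
    = chain_sum g x w.
Proof.
elim: w x => [|d w IH] x /=.
  rewrite (big_pred1 [tuple]) ?big_nil // => l.
  by apply/esym/eqP; rewrite [LHS]tuple0.
rewrite big_mkcond (big_tuple_cons _ _ _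
  (fun l => if chain x (d :: w) l then \prod_(y <- l) g y else 0)) /=.
rewrite [RHS]big_mkcond; apply: eq_bigr => y _.
case: ifP => _; last by rewrite big1.
by rewrite -IH mulr_sumr [RHS]big_mkcond; apply: eq_bigr => l _; rewrite big_cons.
Qed.


(** Reading the choices along the deck [s] instead of by label makes the law of
    [s] a sum over chains. *)
Lemma shelf_law_chains (R : realFieldType) (n m : nat) (p : R) (s : 'S_n.+1) :
  shelf_law m p s = m%:R ^- n.+1 *
    \sum_(y : 'I_m * bool) (if y.2 then p else 1 - p)
       * chain_sum (fun z : 'I_m * bool => if z.2 then p else 1 - p) y
          (descent_word [seq val (s i) | i <- enum 'I_n.+1]).
Proof.
set g := fun z : 'I_m * bool => if z.2 then p else 1 - p.
pose deal (l : n.+1.-tuple ('I_m * bool)) : shelf_choice n.+1 m :=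
  [ffun c => tnth l ((s^-1)%g c)].
have deal_bij : bijective deal.
  exists (fun w : shelf_choice n.+1 m => [tuple w (s i) | i < n.+1]) => [l|w].
    by apply: eq_from_tnth => i; rewrite tnth_mktuple ffunE permK.
  by apply/ffunP => c; rewrite ffunE tnth_mktuple permKV.
rewrite /shelf_law (reindex deal) /=; last exact: onW_bij.
have map_deal l : map (deal l) [seq s i | i <- enum 'I_n.+1] = l.
  rewrite -map_comp (eq_map (g := tnth l)) ?map_tnth_enum // => i /=.
  by rewrite ffunE permK.
have perm_s : perm_eq [seq s i | i <- enum 'I_n.+1] (enum 'I_n.+1).
  apply: uniq_perm; rewrite ?enum_uniq ?(map_inj_uniq perm_inj) ?enum_uniq //.
  by move=> i; rewrite mem_enum -[i](permKV s) map_f ?mem_enum.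
have prob_deal l : choice_prob p (deal l) = m%:R ^- n.+1 * \prod_(y <- l) g y.
  rewrite /choice_prob big_split /= prodr_const card_ord -exprVn.
  congr (_ * _); rewrite (reindex_inj (@perm_inj _ s)) big_tuple.
  by apply: eq_bigr => i _; rewrite ffunE permK.
rewrite (eq_bigr _ (fun l _ => prob_deal l)) -mulr_sumr; congr (_ * _).
rewrite (eq_bigl _ _ (fun l => shuffled_deck_eq _ _ _ _ perm_s)).
rewrite (map_comp val s).
case E : [seq s i | i <- enum 'I_n.+1] => [|c t].
  by have := size_map s (enum 'I_n.+1); rewrite E size_enum_ord.
have size_t : size t = n.
  by have := size_map s (enum 'I_n.+1); rewrite E size_enum_ord => -[].
pose dw := descent_word (map val (c :: t)).
rewrite big_mkcond (eq_bigr (fun l : n.+1.-tuple _ =>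
  if tval l is y :: l1 then
    if chain y dw l1 then \prod_(z <- tval l) g z else 0
  else 0)) => [|l _]; last first.
  by rewrite [sorted _ _]path_deck_order -[tval l]map_deal E.
rewrite (big_tuple_cons _ _ _ (fun l => if l is y :: l1 then
    if chain y dw l1 then \prod_(z <- l) g z else 0 else 0)) /=.
have size_dw : size dw = n by rewrite size_pairmap size_map.
apply: eq_bigr => y _; rewrite -sum_chain -/dw -/(g y) mulr_sumr size_dw.
by rewrite [RHS]big_mkcond; apply: eq_bigr => l _; rewrite big_cons.
Qed.

(** * The law of the shuffled deck *)

(** Transfer recursion with the shelves eliminated: the last card read was
    placed on top if [b].  Going on to a later shelf contributes the factor ['X]
    since, for [m] remaining shelves, the sum over the next one is
    [binom_evalX]. *)
Fixpoint tail_poly {R : comNzRingType} (p : R) (b : bool) (w : seq bool)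
    : {poly R} :=
  if w is d :: w1 then
    let f := p *: tail_poly p true w1 + (1 - p) *: tail_poly p false w1 in
    (if d then (1 - p) *: tail_poly p false w1 else if b then f else 0) + 'X * f
  else 1.

Lemma sum_later_shelves (A : nmodType) (m : nat) (j : 'I_m) (F : nat -> A) :
  \sum_(i : 'I_m | (j < i)%N) F (m - i.+1)%N = \sum_(i < m - j.+1) F i.
Proof.
rewrite (reindex_inj rev_ord_inj) (big_ord_widen m) ?leq_subr //=.
apply: eq_big => [i|i _] /=; first by rewrite !ltn_subRL !addSn addnC.
by rewrite subnSK // subKn // ltnW.
Qed.

Lemma chain_sum_tail (R : comNzRingType) (m : nat) (p : R) (w : seq bool)
    (j : 'I_m) (b : bool) :
  chain_sum (fun z : 'I_m * bool => if z.2 then p else 1 - p) (j, b) w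
    = binom_eval (m - j.+1) (tail_poly p b w).
Proof.
elim: w j b => [|d w IH] j b /=.
  rewrite /binom_eval big_ord_recl coef1 mul1r bin0 big1 ?addr0 // => i _.
  by rewrite coef1 mul0r.
set f := p *: _ + _; set g := fun z : 'I_m * bool => if z.2 then p else 1 - p in IH *.
rewrite raddfD /= binom_evalX -(sum_later_shelves _ _ _ (fun i => binom_eval i f)).
transitivity (\sum_i \sum_(c | follows d (j, b) (i, c))
                g (i, c) * chain_sum g (i, c) w).
  by rewrite pair_big_dep; apply: eq_big => [[i c]|[i c]].
(* The next shelf is the present one, an earlier one (excluded) or a later one. *)
rewrite (bigD1 j) //= [X in _ + X](bigID (fun i : 'I_m => (j < i)%N)) /=.
have both i : \sum_c g (i, c) * chain_sum g (i, c) w = binom_eval (m - i.+1) f.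
  by rewrite big_bool /= !IH raddfD /= !linearZ.
rewrite [X in _ + (_ + X)]big1 ?addr0; last first.
  move=> i /andP[/negPf ne_ij /negPf lt_ji]; apply: big1 => c.
  by rewrite /follows /= lt_ji eq_sym ne_ij.
congr (_ + _); last first.
  apply: eq_big => [i|i /andP[_ lt_ji]].
    by case: ltnP => lt_ji; rewrite ?andbF // andbT -val_eqE /= gtn_eqF.
  by rewrite -both; apply: eq_bigl => c; rewrite /follows /= lt_ji.
rewrite big_mkcond big_bool /follows /= ltnn eqxx /=.
case: d; first by rewrite add0r IH linearZ.
case: b; last by rewrite addr0 raddf0.
by rewrite !IH raddfD /= !linearZ.
Qed.

(** The first card read on a shelf has side top with probability [p].  With this
    mixture the recursion multiplies by [p + 'X] at an ascent, by [1 - p + 'X]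
    at a descent, and by ['X * (p + 'X) + (1 - p) * 'X = 'X * (1 + 'X)] at a
    valley, because a valley forces a change of shelf. *)
Lemma tail_poly_weight (R : comNzRingType) (p : R) (w : seq bool) :
  p *: tail_poly p true w + (1 - p) *: tail_poly p false w
    = weight (p%:P + 'X) ((1 - p)%:P + 'X) ('X * (1 + 'X)) w.
Proof.
elim/word_ind: w => [|w IH||w IH|w IH].
- by rewrite /= -scalerDl addrC subrK scale1r.
- rewrite /= -IH -!mul_polyC polyCB; ring.
- by rewrite /= -!mul_polyC polyCB; ring.
- by rewrite /= -IH -!mul_polyC polyCB; ring.
- rewrite weightDD -IH /= -!mul_polyC polyCB; ring.
Qed.

(** The sum over the shelf of the topmost card is once more a sum over the number
    of remaining shelves, which turns [binom_eval] into [shelf_eval]. *)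
Lemma shelf_law_shelf_eval (R : realFieldType) (n m : nat) (p : R)
    (s : 'S_n.+1) :
  shelf_law m p s = m%:R ^- n.+1 *
    shelf_eval m (weight (p%:P + 'X) ((1 - p)%:P + 'X) ('X * (1 + 'X))
                  (descent_word [seq val (s i) | i <- enum 'I_n.+1])).
Proof.
rewrite shelf_law_chains; congr (_ * _); set w := descent_word _.
transitivity (\sum_(j : 'I_m) \sum_(b : bool) (if b then p else 1 - p)
    * chain_sum (fun z : 'I_m * bool => if z.2 then p else 1 - p) (j, b) w).
  by rewrite pair_bigA; apply: eq_bigr => [[j b]].
rewrite /shelf_eval binom_evalX (reindex_inj rev_ord_inj) /=.
apply: eq_bigr => j _; rewrite big_bool /= !chain_sum_tail -tail_poly_weight.
by rewrite /= subnSK // subKn ?(ltnW (ltn_ord j)) // raddfD /= !linearZ.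
Qed.

(** * From permutations to descent words *)

Lemma descent_word_map_succ (t : seq nat) :
  descent_word (map S t) = descent_word t.
Proof.
case: t => //= x t; elim: t x => //= y t IH x; by rewrite IH ltnS.
Qed.

Lemma descent_word_insert0 (t : seq nat) :
  (0 < size t)%N -> all (fun k => 0 < k)%N t ->
  [seq descent_word (take i t ++ 0%N :: drop i t) | i <- iota 0 (size t).+1]
    = inserts (descent_word t).
Proof.
have iotaS k : iota 0 k.+1 = 0%N :: map S (iota 0 k) by rewrite -(iotaDl 1 0).
case: t => // x t _ /andP[x_gt0 t_gt0]; rewrite /inserts -cats1.
rewrite iotaS map_cons -map_comp; congr (_ :: _).
elim: t x x_gt0 t_gt0 => [|y t IH] x x_gt0; first by rewrite /= x_gt0.
case/andP=> y_gt0 t_gt0; rewrite iotaS map_cons -map_comp.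
rewrite [X in X :: _](_ : _ = [:: true, false & descent_word (y :: t)]).
  2: by rewrite /= x_gt0.
congr (_ :: _).
have /= := congr1 (map (cons (y < x)%N)) (IH y y_gt0 t_gt0).
by rewrite -!map_comp map_cat.
Qed.

Lemma lift_perm_deck (n : nat) (i : 'I_n.+1) (s : 'S_n) :
  let t := [seq (val (s k)).+1 | k <- enum 'I_n] in
  [seq val (lift_perm i ord0 s k) | k <- enum 'I_n.+1]
    = take i t ++ 0%N :: drop i t.
Proof.
move=> t; have size_t : size t = n by rewrite size_map size_enum_ord.
have size_take_t : size (take i t) = i.
  by rewrite size_takel // size_t -ltnS.
apply: (@eq_from_nth _ 0%N) => [|k].
  by rewrite size_map size_enum_ord size_cat size_take_t /= size_drop size_t
             addnS subnKC // -ltnS.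
rewrite size_map size_enum_ord => lt_kn.
rewrite (nth_map ord0) ?size_enum_ord //.
have -> : nth ord0 (enum 'I_n.+1) k = Ordinal lt_kn.
  by rewrite -[k in LHS]/(val (Ordinal lt_kn)) nth_ord_enum.
rewrite nth_cat size_take_t.
case: (unliftP i (Ordinal lt_kn)) => [k1|] /(congr1 val) /= eq_k.
  have nth_t : nth 0%N t k1 = (val (s k1)).+1.
    by rewrite (nth_map k1) ?size_enum_ord // nth_ord_enum.
  have -> : Ordinal lt_kn = lift i k1 by apply: val_inj.
  rewrite lift_perm_lift eq_k /= /bump /= add1n.
  case: (leqP i k1) => [le_ik|lt_ki].
    by rewrite add1n ltnNge leqW //= subSn //= nth_drop subnKC // nth_t.
  by rewrite add0n lt_ki nth_take // nth_t.
have -> : Ordinal lt_kn = i by apply: val_inj.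
by rewrite lift_perm_id eq_k ltnn subnn.
Qed.

(** Every deck of [n.+2] cards arises exactly once by inserting the smallest card
    into a deck of [n.+1] cards. *)
Lemma sum_perm_words (A : nmodType) (n : nat) (F : seq bool -> A) :
  \sum_(s : 'S_n.+1) F (descent_word [seq val (s i) | i <- enum 'I_n.+1])
    = \sum_(w <- words n) F w.
Proof.
elim: n F => [|n IH] F.
  rewrite big_seq1 (eq_bigr (fun=> F [::])) => [|s _].
    by rewrite sumr_const card_Sn.
  by rewrite enum_ordSl (size0nil (size_enum_ord 0)).
pose f (x : 'I_n.+2 * 'S_n.+1) := lift_perm x.1 ord0 x.2.
have f_inj : injective f.
  move=> [i s] [j t] /= eq_f; have eq_ij : i = j.
    by apply: (@perm_inj _ (f (i, s))); rewrite {2}eq_f /f /= !lift_perm_id.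
  move: eq_f; rewrite {}eq_ij /f /= => /permP eq_f; congr (_, _).
  apply/permP => k; apply: (@lift_inj _ ord0).
  by rewrite -!(lift_perm_lift j) eq_f.
rewrite (reindex f) /=; last first.
  apply: onW_bij; apply: inj_card_bij => //.
  by rewrite card_prod !card_Sn card_ord factS.
rewrite -(pair_bigA _ (fun i s =>
  F (descent_word [seq val (f (i, s) k) | k <- enum 'I_n.+2]))).
rewrite exchange_big /= big_flatten big_map -IH; apply: eq_bigr => s _.
set t := [seq val (s i) | i <- _].
have size_t : size (map S t) = n.+1 by rewrite 2!size_map size_enum_ord.
rewrite -(descent_word_map_succ t) -descent_word_insert0 ?size_t //; last first.
  by apply/allP => _ /mapP[k _ ->].
rewrite big_map -val_enum_ord big_map big_enum /=; apply: eq_bigr => i _.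
by rewrite /f lift_perm_deck /t -map_comp.
Qed.

Lemma des_descent_word (n : nat) (s : 'S_n.+1) :
  des s = count id (descent_word [seq val (s i) | i <- enum 'I_n.+1]).
Proof.
set t := map _ _; have size_t : size t = n.+1 by rewrite size_map size_enum_ord.
have nth_t (i : 'I_n.+1) : nth 0%N t i = s i.
  by rewrite (nth_map i) ?size_enum_ord // nth_ord_enum.
have nth_dw i : (i < n)%N ->
    nth false (descent_word t) i = (nth 0%N t i.+1 < nth 0%N t i)%N.
  case: (t) size_t => // x t1 [size_t1] lt_in /=.
  by rewrite (nth_pairmap 0%N) ?size_t1.
have size_dw : size (descent_word t) = n.
  by case: (t) size_t => // x t1 [size_t1]; rewrite size_pairmap.
rewrite -sum1_count (big_nth false) size_dw big_mkord.
rewrite /des cardsE -sum1_card [RHS]big_mkcond [LHS]big_mkcond big_ord_recr /=.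
rewrite [X in (_ + X)%N]ifF ?addn0; last first.
  apply/negbTE/existsP => -[j /andP[/eqP eq_j _]].
  by have := ltn_ord j; rewrite eq_j ltnn.
apply: eq_bigr => i _; congr (if _ then _ else _).
rewrite nth_dw // unfold_in; apply/existsP/idP => /= [[j /andP[/eqP eq_j]]|lt_s].
  by rewrite -nth_t -eq_j nth_t -(nth_t (widen_ord _ i)).
exists (lift ord0 i); rewrite /= eqxx /=.
by rewrite -(nth_t (widen_ord _ i)) -nth_t.
Qed.

(** * The first two moments *)

(** The [k]-th derivative in [sigma] of the gamma expansion, evaluated on the
    curve [sigma = 1 + 2 'X], [K = 'X * (1 + 'X)] on which the weights of the
    shelf shuffle lie, for every [p]. *)
Definition gamma_poly {R : comNzRingType} (n k : nat) : {poly R} :=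
  \sum_(x <- gamma_terms n)
    (x.1 ^_ k)%:R * ((1 + 2 * 'X) ^+ (x.1 - k) * ('X * (1 + 'X)) ^+ x.2).

(** Rests on [sigma ^+ 2 - 4 K = 1] along the curve. *)
Lemma deriv_gamma_monomial (R : comNzRingType) (a v : nat) :
  let sigma : {poly R} := 1 + 2 * 'X in
  let K : {poly R} := 'X * (1 + 'X) in
  2 * K * (sigma ^+ a * K ^+ v)^`()
    = (a + 2 * v)%:R * (sigma * (sigma ^+ a * K ^+ v))
      - a%:R * (sigma ^+ a.-1 * K ^+ v).
Proof.
move=> sigma K.
have dsigma : sigma^`() = 2 by rewrite /sigma derivD derivC add0r !derivE; ring.
have dK : K^`() = sigma by rewrite /K /sigma derivM !derivE; ring.
rewrite derivM !deriv_exp dsigma dK natrD natrM.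
have sigma2 : sigma * sigma = 1 + 4 * K by rewrite /sigma /K; ring.
case: a => [|a]; case: v => [|v] /=; rewrite ?mulr0n ?exprS.
- by ring.
- by ring.
- by ring: sigma2.
- by ring: sigma2.
Qed.

(** The monomials [sigma ^+ a * K ^+ v] with [a + 2 v = n] are homogeneous of
    weight [n], so that a derivative across the curve is determined by the
    derivative along it. *)
Lemma gamma_polyS (R : comNzRingType) (n k : nat) :
  gamma_poly n k.+1 = (n - k)%:R * ((1 + 2 * 'X) * gamma_poly n k)
     - 2 * ('X * (1 + 'X)) * (gamma_poly n k)^`() :> {poly R}.
Proof.
rewrite /gamma_poly !raddf_sum /= !mulr_sumr -sumrB.
rewrite big_seq [RHS]big_seq; apply: eq_bigr => -[a v] /gamma_terms_size /= eq_n.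
(* A term with [a < k] has vanished on both sides. *)
have [le_ka|lt_ak] := leqP k a; last first.
  rewrite !ffact_small ?ltnS ?(ltnW lt_ak) // mul0r mul0r !mulr0 raddf0 mulr0.
  by rewrite subr0.
have -> (f : {poly R}) : ((a ^_ k)%:R * f)^`() = (a ^_ k)%:R * f^`().
  by rewrite !mulr_natl derivMn.
rewrite [_ * (_%:R * _^`())]mulrCA deriv_gamma_monomial ffactnSr natrM.
have -> : (a - k + 2 * v)%N = (n - k)%N by rewrite -eq_n addnBAC.
by rewrite subnS; ring.
Qed.

Lemma shelf_eval_natl (R : comNzRingType) (m c : nat) (f : {poly R}) :
  shelf_eval m (c%:R * f) = c%:R * shelf_eval m f.
Proof. by rewrite !mulr_natl raddfMn. Qed.

Lemma shelf_eval_sigma (R : comNzRingType) (m : nat) (f : {poly R}) :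
  shelf_eval m ((1 + 2 * 'X) * f) = shelf_eval m f + 2 * \sum_(i < m) shelf_eval i f.
Proof. by rewrite -shelf_evalX mulrDl mul1r raddfD /= -mulrA shelf_eval_natl. Qed.

Lemma shelf_eval_Kderiv (R : comNzRingType) (m : nat) (f : {poly R}) :
  shelf_eval m (2 * ('X * (1 + 'X)) * f^`())
    = 2 * (m%:R * shelf_eval m f - shelf_eval m ((1 + 2 * 'X) * f)).
Proof.
rewrite -shelf_eval_deriv -mulrA shelf_eval_natl -raddfB /=.
by congr (_ * shelf_eval _ _); rewrite !derivM !derivE; ring.
Qed.

Lemma shelf_eval_gamma_polyS (R : comNzRingType) (m n k : nat) :
  shelf_eval m (gamma_poly n k.+1 : {poly R})
    = (n - k).+2%:R * shelf_eval m ((1 + 2 * 'X) * gamma_poly n k)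
      - 2 * m%:R * shelf_eval m (gamma_poly n k).
Proof.
rewrite gamma_polyS raddfB /= shelf_eval_natl shelf_eval_Kderiv.
by rewrite -addn2 natrD; ring.
Qed.

Lemma expectation_words (R : realFieldType) (n m : nat) (p : R) (f : nat -> nat) :
  expectation (shelf_law m p) (fun s : 'S_n.+1 => (f (des s))%:R)
    = m%:R ^- n.+1 * shelf_eval m (\sum_(w <- words n) (f (count id w))%:R *
        weight (p%:P + 'X) ((1 - p)%:P + 'X) ('X * (1 + 'X)) w).
Proof.
rewrite raddf_sum mulr_sumr -sum_perm_words; apply: eq_bigr => s _.
by rewrite /= shelf_law_shelf_eval des_descent_word shelf_eval_natl; ring.
Qed.

(** The probabilities of all decks add up to 1; at any [p] this computes the
    evaluation of the gamma expansion, in which [p] does not occur. *)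
Lemma shelf_eval_gamma_poly0 (R : realFieldType) (m n : nat) :
  shelf_eval m (gamma_poly n 0 : {poly R}) = m%:R ^+ n.+1.
Proof.
case: m => [|m]; first by rewrite /shelf_eval binom_evalX big_ord0 exprS mul0r.
have := expectation_words R n m.+1 0 (fun=> 1%N).
rewrite /expectation (eq_bigr _ (fun s _ => mulr1 _)) sum_shelf_law //.
rewrite (eq_bigr _ (fun w _ => mul1r _)) sum_weight_words => /esym.
have m_neq0 : (m.+1%:R ^- n.+1 : R) != 0.
  by rewrite invr_eq0 expf_neq0 // pnatr_eq0.
move/(canRL (mulKf m_neq0)); rewrite invrK mulr1 => <-.
congr shelf_eval; apply: eq_bigr => x _.
rewrite ffactn0 mul1r subn0; congr (_ ^+ _ * _).
by rewrite polyCB; ring.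
Qed.

(** On a term [(a, v)] the descents are [v] forced ones and, among [a] free gaps,
    each one with weight [s = (sigma - (2 p - 1)) / 2] against
    [u = (sigma + (2 p - 1)) / 2]; substituting these values makes the result
    polynomial in [2 p - 1]. *)
Lemma sum_des_gamma (R : comNzRingType) (n : nat) (p : R) :
  2 * (\sum_(w <- words n) (count id w)%:R *
        weight (p%:P + 'X) ((1 - p)%:P + 'X) ('X * (1 + 'X)) w)
    = n%:R * gamma_poly n 0 - (2 * p - 1)%:P * gamma_poly n 1.
Proof.
rewrite sum_des_words mulr_sumr /gamma_poly !mulr_sumr -sumrB.
rewrite big_seq [RHS]big_seq; apply: eq_bigr => -[a v] /gamma_terms_size /= <-.
rewrite !polyCB polyCM !polyC1 -/(2%:R : R) polyC_natr.
have -> : p%:P + 'X + (1 - p%:P + 'X) = 1 + 2 * 'X :> {poly R} by ring.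
set sigma := 1 + _.
rewrite ffactn0 ffactn1 subn0 subn1 natrD natrM.
case: a => [|a]; rewrite ?exprS /=; first by ring.
by move: (sigma ^+ a) => sigma_a; rewrite /sigma; ring.
Qed.

Lemma sum_des_des1_gamma (R : comNzRingType) (n : nat) (p : R) :
  4 * (\sum_(w <- words n) (count id w * (count id w + 1))%:R *
        weight (p%:P + 'X) ((1 - p)%:P + 'X) ('X * (1 + 'X)) w)
    = (n%:R * (n%:R + 2))%:P * gamma_poly n 0
      - (2 * (n%:R + 1) * (2 * p - 1))%:P * gamma_poly n 1
      + (1 + 2 * 'X) * gamma_poly n 1
      + ((2 * p - 1) ^+ 2)%:P * gamma_poly n 2.
Proof.
rewrite sum_des_des1_words mulr_sumr /gamma_poly !mulr_sumr -sumrB -!big_split.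
rewrite big_seq [RHS]big_seq; apply: eq_bigr => -[a v] /gamma_terms_size /= <-.
rewrite rmorphXn !polyCM !polyCB !polyCD !polyCM !polyC1 -!/(2%:R : R) !polyC_natr.
have -> : p%:P + 'X + (1 - p%:P + 'X) = 1 + 2 * 'X :> {poly R} by ring.
set sigma := 1 + _.
rewrite ffactn0 ffactn1 ffactnSr ffactn1 subn0 natrD natrM.
rewrite natrM; case: a => [|[|a]]; rewrite ?subn2 ?subn1 ?exprS /=.
- by ring.
- by rewrite /sigma; ring.
- by move: (sigma ^+ a) => sigma_a; rewrite /sigma; ring.
Qed.

Theorem corollary2p10 (R : realFieldType) (n m : nat) (p : R)
    (n_ge1 : (1 <= n)%N) (m_ge1 : (1 <= m)%N) (p_gt0 : 0 < p) (p_lt1 : p < 1) :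
  let delta : R := 2 * p - 1 in
  let N : R := n%:R in
  let M : R := m%:R in
  let Sn : R := power_sum R n m in
  let Sn1 : R := power_sum R n.+1 m in
  expectation (shelf_law m p) (fun s : 'S_n => (des s)%:R)
    = (N - 1) / 2 + delta * (M - (N + 1) / 2 - (N + 1) / M ^+ n * Sn)
  /\
  expectation (shelf_law m p) (fun s : 'S_n => (des s * (des s + 1))%:R)
    = N * (N + 1) / 4 - M / 2
      + ((N + 1) * M * Sn - (N + 2) * Sn1) / M ^+ n
      + delta * (N * M - N * (N + 1) / 2 - N * (N + 1) / M ^+ n * Sn)
      + delta ^+ 2 * (M ^+ 2 - (N + 1 / 2) * M + N * (N + 1) / 4
          + ((N ^+ 2 - 1) * M * Sn - N * (N + 2) * Sn1) / M ^+ n).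
Proof.
(* From here on [n.+1] is the number of cards and [n] the number of gaps. *)
case: n n_ge1 => // n _ delta N M Sn Sn1.
pose L0 k : R := shelf_eval k (gamma_poly n 0).
pose L1 k : R := shelf_eval k (gamma_poly n 1).
have L0E k : L0 k = k%:R ^+ n.+1 by exact: shelf_eval_gamma_poly0.
have sum_L0 k : \sum_(i < k) L0 i = power_sum R n.+1 k.
  by rewrite /power_sum big_mkord; apply: eq_bigr => i _.
have n2 : n.+2%:R = n%:R + 2 :> R by rewrite -addn2 natrD.
have L1E k : L1 k = (n%:R + 2) * (k%:R ^+ n.+1 + 2 * power_sum R n.+1 k)
                    - 2 * k%:R ^+ n.+2.
  rewrite /L1 shelf_eval_gamma_polyS shelf_eval_sigma -/(L0 k) sum_L0 L0E subn0.
  by rewrite n2 [k%:R ^+ n.+2]exprS; ring.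
(* The double sum over [a < i < k] counts each [a] with multiplicity [k - 1 - a]. *)
have sum_S k : \sum_(i < k) power_sum R n.+1 i
               = (k%:R - 1) * power_sum R n.+1 k - power_sum R n.+2 k.
  elim: k => [|k IH]; first by rewrite big_ord0 /power_sum !big_nil; ring.
  rewrite big_ord_recr /= IH /power_sum !big_nat_recr //= [k%:R ^+ n.+2]exprS.
  by rewrite -[k.+1]addn1 natrD; ring.
have sum_L1 : \sum_(i < m) L1 i
    = (n%:R + 2) * (Sn + 2 * ((M - 1) * Sn - Sn1)) - 2 * Sn1.
  under eq_bigr => i _ do rewrite L1E.
  rewrite sumrB -!mulr_sumr big_split /=.
  by rewrite -mulr_sumr sum_S /Sn /Sn1 /power_sum !big_mkord.
have evalC (c : R) f : shelf_eval m (c%:P * f) = c * shelf_eval m f.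
  by rewrite mul_polyC linearZ.
have M_neq0 : M != 0 by rewrite pnatr_eq0 -lt0n.
have L2E : shelf_eval m (gamma_poly n 2 : {poly R})
    = n.+1%:R * shelf_eval m ((1 + 2 * 'X) * gamma_poly n 1) - 2 * M * L1 m.
  (* For a single card [n - 1] is truncated, but then the first derivative is 0. *)
  rewrite shelf_eval_gamma_polyS -/(L1 m) subn1; case: (n) => //.
  by rewrite /gamma_poly big_seq1 /= mul0r mulr0 raddf0 !mulr0.
rewrite shelf_eval_sigma -/(L1 m) sum_L1 L1E in L2E.
have eval1 : shelf_eval m ((1 + 2 * 'X) * gamma_poly n 1)
             = L1 m + 2 * \sum_(i < m) L1 i.
  exact: shelf_eval_sigma.
rewrite sum_L1 L1E in eval1.
have eD := congr1 (shelf_eval m) (sum_des_gamma R n p).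
rewrite [RHS]raddfB /= !shelf_eval_natl evalC -/(L0 m) -/(L1 m) L0E L1E in eD.
have eDD := congr1 (shelf_eval m) (sum_des_des1_gamma R n p).
rewrite shelf_eval_natl [RHS]raddfD /= ![in RHS](raddfD, raddfN) /= in eDD.
rewrite !evalC eval1 L2E -/(L0 m) -/(L1 m) L0E L1E in eDD.
have N1 : N = n%:R + 1 by rewrite /N -addn1 natrD.
have Mn_neq0 : M ^+ n.+1 != 0 by rewrite expf_neq0.
have eD0 := expectation_words R n m p id.
have eDD0 := expectation_words R n m p (fun d => d * (d + 1))%N.
rewrite /= in eD0 eDD0; rewrite eD0 eDD0 {eD0 eDD0}.
have two_neq0 : (2 : R) != 0 by rewrite pnatr_eq0.
have four_neq0 : (4 : R) != 0 by rewrite pnatr_eq0.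
rewrite (canRL (mulKf two_neq0) eD) (canRL (mulKf four_neq0) eDD).
rewrite -/N N1 /delta -/Sn -/M [M ^+ n.+2]exprS.
by move: (M ^+ n.+1) Mn_neq0 => Mn Mn_neq0; split; field.
Qed.
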